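(* Let $\mathbf{T}\in\mathbb{N}^{n_1\times n_2\times n_3}$ be a nonzero contingency table and let $\mathbf{F}=\mathbf{T}/\sum_{i,j,k}T_{ijk}$ be its frequency tensor. For $\mu\in\{1,2,3\}$ let $\mathbf{f}^\mu\in\mathbb{R}^{n_\mu}$ be the mode-$\mu$ marginal of $\mathbf{F}$, assumed to have no zero component, and let $D_\mu=\operatorname{diag}(\sqrt{\mathbf{f}^\mu})$. View $\mathbf{F}$ as an element of the space $\mathcal{S}_M=\mathbb{R}^{n_1\times n_2\times n_3}$ endowed with the inner product induced by the matrices $D_1^{-1},D_2^{-1},D_3^{-1}$, and let $Z_\mu\in\mathbb{R}^{n_\mu\times r_\mu}$ be the scaled principal components of mode $\mu$ of $\mathbf{F}$ in $\mathcal{S}_M$ at multilinear rank $(r_1,r_2,r_3)$, with $\mathbf{z}^\mu_{i}$ denoting the $i$-th row of $Z_\mu$. If $r_\mu=\operatorname{rank}(F^{(\mu)})$ for every $\mu\in\{1,2,3\}$, then for all $i\in\{1,\dots,n_1\}$, $j\in\{1,\dots,n_2\}$, $k\in\{1,\dots,n_3\}$, $\ell\in\{1,\dots,r_1\}$, $m\in\{1,\dots,r_2\}$, $p\in\{1,\dots,r_3\}$ (in each line the row index of the left-hand side is fixed and the other two are summed over), $$\begin{aligned} (z^1_i)_\ell&=\frac{1}{\sigma^1_\ell}\sum_{j=1}^{n_2}\sum_{k=1}^{n_3}\sum_{m=1}^{r_2}\sum_{p=1}^{r_3}\frac{F_{ijk}}{f^1_i}(z^3_k)_p(z^2_j)_m(B_1)_{\ell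 mp},\\ (z^2_j)_m&=\frac{1}{\sigma^2_m}\sum_{i=1}^{n_1}\sum_{k=1}^{n_3}\sum_{\ell=1}^{r_1}\sum_{p=1}^{r_3}\frac{F_{ijk}}{f^2_j}(z^3_k)_p(z^1_i)_\ell(B_2)_{\ell mp},\\ (z^3_k)_p&=\frac{1}{\sigma^3_p}\sum_{i=1}^{n_1}\sum_{j=1}^{n_2}\sum_{\ell=1}^{r_1}\sum_{m=1}^{r_2}\frac{F_{ijk}}{f^3_k}(z^1_i)_\ell(z^2_j)_m(B_3)_{\ell mp}, \end{aligned}$$ where $B_\mu\in\mathbb{R}^{r_1\times r_2\times r_3}$ is the tensor whose mode-$\mu$ matricization is $\Sigma_\mu B^{(\mu)}$, with $\mathbf{B}=(\Sigma_1^{-1},\Sigma_2^{-1},\Sigma_3^{-1})\mathbf{C}$.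
   Context: For a tensor $\mathbf{A}\in\mathbb{R}^{n_1\times\dots\times n_d}$, the matricization $A^{(\mu)}$ with respect to mode $\mu$ is the matrix with $n_\mu$ rows and $\prod_{\alpha\neq\mu}n_\alpha$ columns whose entry in row $i_\mu$ and column $1+\sum_{\alpha\ne\mu}(i_\alpha-1)m_\alpha$, with $m_\alpha=\prod_{\beta<\alpha,\ \beta\neq\mu}n_\beta$, is $A_{i_1\dots i_d}$. For matrices $M_\mu$ of compatible size, $(M_1,\dots,M_d)\mathbf{A}$ is the tensor-times-matrix product: $(M_1,\dots,M_d)(\mathbf{a}_1\otimes\dots\otimes\mathbf{a}_d)=M_1\mathbf{a}_1\otimes\dots\otimes M_d\mathbf{a}_d$, extended linearly. The inner product induced by symmetric positive definite matrices $M_\mu$ is $\langle\mathbf{A},\mathbf{A}'\rangle=\langle(M_1,\dots,M_d)\mathbf{A},(M_1,\dots,M_d)\mathbf{A}'\rangle$. The mode-$\mu$ marginal $\mathbf{f}^\mu$ is the vector whose $i_\mu$-th component $f^\mu_{i_\mu}$ is the sum of all entries of $\mathbf{F}$ with $\mu$-th index equal to $i_\mu$; e.g. $f^1_i=\sum_{j,k}F_{ijk}$. The square root in $\operatorname{diag}(\sqrt{\mathbf{f}^\mu})$ is componentwise. Let $\mathbf{X}=(D_1^{-1},D_2^{-1},D_3^{-1})\mathbf{F}$, i.e. $X_{ijk}=F_{ijk}/\sqrt{f^1_if^2_jf^3_k}$. The HOSVD of $\mathbf{X}$ at multilinear rank $(r_1,r_2,r_3)$ consists of matrices $U_\mu\in\mathbb{R}^{n_\mu\times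 r_\mu}$ whose columns are orthonormal left singular vectors of $X^{(\mu)}$ associated with its $r_\mu$ largest singular values $\sigma^\mu_1\ge\dots\ge\sigma^\mu_{r_\mu}$, together with the core $\mathbf{C}=(U_1^{T},U_2^{T},U_3^{T})\mathbf{X}$. Put $\Sigma_\mu=\operatorname{diag}(\sigma^\mu_1,\dots,\sigma^\mu_{r_\mu})$, $Y_\mu=U_\mu\Sigma_\mu$ (principal components of $\mathbf{X}$), $W_\mu=D_\mu Y_\mu$ (principal components of $\mathbf{F}$ in $\mathcal{S}_M$), and $Z_\mu=D_\mu^{-2}W_\mu$ (scaled principal components of $\mathbf{F}$ in $\mathcal{S}_M$). *)

(* Defs.v *)
(* [R : realType] plays the role of the real numbers. *)
From HB Require Import structures.
From mathcomp Require Export all_boot all_order all_algebra.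
From mathcomp Require Export reals.
From mathcomp Require Import ring.

Set Implicit Arguments.
Unset Strict Implicit.
Unset Printing Implicit Defensive.

Import Order.TTheory GRing.Theory Num.Theory.
Local Open Scope ring_scope.

Definition tensor (K : Type) (n1 n2 n3 : nat) : Type :=
  {ffun 'I_n1 * 'I_n2 * 'I_n3 -> K}.

Section Tensors.
Variable R : realType.

(* [mxvec] is row major (see [mxvec_index_val]), so that the smallest
   remaining mode varies fastest along the columns of a matricization. *)
Definition unfold1 n1 n2 n3 (A : tensor R n1 n2 n3) : 'M[R]_(n1, n3 * n2) :=
  \matrix_(i < n1) mxvec (\matrix_(k < n3, j < n2) A (i, j, k)).

Definition unfold2 n1 n2 n3 (A : tensor R n1 n2 n3) : 'M[R]_(n2, n3 * n1) :=
  \matrix_(j < n2) mxvec (\matrix_(k < n3, i < n1) A (i, j, k)).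

Definition unfold3 n1 n2 n3 (A : tensor R n1 n2 n3) : 'M[R]_(n3, n2 * n1) :=
  \matrix_(k < n3) mxvec (\matrix_(j < n2, i < n1) A (i, j, k)).

Lemma mxvec_index_val m n (i : 'I_m) (j : 'I_n) :
  mxvec_index i j = (i * n + j)%N :> nat.
Proof.
have idx (s : seq 'I_m) (t : seq 'I_n) : i \in s -> j \in t ->
    index (i, j) [seq (x, y) | x <- s, y <- t] =
      (index i s * size t + index j t)%N.
  move=> + jt; elim: s => //= x s IHs; rewrite inE index_cat.
  have [-> _ | xi /= si] := eqVneq x i.
    by rewrite map_f ?index_map // => y z [].
  rewrite ifN ?size_map ?IHs ?mulSn ?addnA //.
  by apply/mapP => -[y _ [ix]]; rewrite ix eqxx in xi.
rewrite /mxvec_index /= /enum_rank enum_rank_in.unlock insubdK; last first.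
  by rewrite -[_ \in _]/(_ < _)%N cardE index_mem mem_enum.
rewrite enumT Finite.enum.unlock /= /prod_enum idx ?mem_enum //.
by rewrite !index_enum_ord size_enum_ord.
Qed.

Definition outer n1 n2 n3 (a : 'cV[R]_n1) (b : 'cV[R]_n2) (c : 'cV[R]_n3) :
    tensor R n1 n2 n3 :=
  [ffun t => a t.1.1 0 * b t.1.2 0 * c t.2 0].

(* Since A is the sum of the A (a, b, c) e_a (x) e_b (x) e_c, this is the
   linear extension of the rule [ttm_outer] on elementary tensors. *)
Definition ttm m1 m2 m3 n1 n2 n3
    (M1 : 'M[R]_(m1, n1)) (M2 : 'M[R]_(m2, n2)) (M3 : 'M[R]_(m3, n3))
    (A : tensor R n1 n2 n3) : tensor R m1 m2 m3 :=
  [ffun t => \sum_a \sum_b \sum_c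
     M1 t.1.1 a * M2 t.1.2 b * M3 t.2 c * A (a, b, c)].

Lemma ttm_outer m1 m2 m3 n1 n2 n3
    (M1 : 'M[R]_(m1, n1)) (M2 : 'M[R]_(m2, n2)) (M3 : 'M[R]_(m3, n3))
    (a : 'cV[R]_n1) (b : 'cV[R]_n2) (c : 'cV[R]_n3) :
  ttm M1 M2 M3 (outer a b c) = outer (M1 *m a) (M2 *m b) (M3 *m c).
Proof.
apply/ffunP => -[[i j] k]; rewrite !ffunE /= !mxE.
rewrite -mulrA mulr_suml; apply: eq_bigr => x _.
rewrite mulr_suml mulr_sumr; apply: eq_bigr => y _.
rewrite !mulr_sumr; apply: eq_bigr => z _; rewrite ffunE /=; ring.
Qed.

Definition frequency n1 n2 n3 (T : tensor nat n1 n2 n3) : tensor R n1 n2 n3 :=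
  [ffun t => (T t)%:R / (\sum_i \sum_j \sum_k T (i, j, k))%N%:R].

Definition marginal1 n1 n2 n3 (F : tensor R n1 n2 n3) : 'rV[R]_n1 :=
  \row_i \sum_j \sum_k F (i, j, k).

Definition marginal2 n1 n2 n3 (F : tensor R n1 n2 n3) : 'rV[R]_n2 :=
  \row_j \sum_i \sum_k F (i, j, k).

Definition marginal3 n1 n2 n3 (F : tensor R n1 n2 n3) : 'rV[R]_n3 :=
  \row_k \sum_i \sum_j F (i, j, k).

Definition diag_sqrt n (f : 'rV[R]_n) : 'M[R]_n := diag_mx (map_mx Num.sqrt f).

(* [s] lists the min(m, n) singular values of A, with multiplicity and in
   nonincreasing order: they form the diagonal of a full SVD of A. *)
Definition singular_values m n (A : 'M[R]_(m, n)) (s : seq R) : Prop :=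
  [/\ size s = minn m n, sorted >=%R s, {in s, forall x, 0 <= x} &
    exists (U : 'M[R]_m) (V : 'M[R]_n),
      [/\ U^T *m U = 1%:M, V^T *m V = 1%:M &
          A = U *m (\matrix_(i < m, j < n) (s`_i *+ (i == j :> nat))) *m V^T]].

Definition unit_vector n (u : 'cV[R]_n) : Prop := \sum_i u i 0 ^+ 2 = 1.

Definition left_singular_vector m n (A : 'M[R]_(m, n)) (sigma : R)
    (u : 'cV[R]_m) : Prop :=
  unit_vector u /\ exists v : 'cV[R]_n,
    [/\ unit_vector v, A *m v = sigma *: u & A^T *m u = sigma *: v].

(* [sigma] consists of the r largest singular values of A and the columns of
   [U] are orthonormal left singular vectors associated with them. *)
Definition leading_left_singular m n r (A : 'M[R]_(m, n))
    (U : 'M[R]_(m, r)) (sigma : 'rV[R]_r) : Prop :=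
  [/\ exists s : seq R, [/\ singular_values A s, (r <= size s)%N &
        forall l : 'I_r, sigma 0 l = s`_l],
      U^T *m U = 1%:M &
      forall l : 'I_r, left_singular_vector A (sigma 0 l) (col l U)].

Definition is_hosvd n1 n2 n3 r1 r2 r3 (X : tensor R n1 n2 n3)
    (U1 : 'M[R]_(n1, r1)) (sigma1 : 'rV[R]_r1)
    (U2 : 'M[R]_(n2, r2)) (sigma2 : 'rV[R]_r2)
    (U3 : 'M[R]_(n3, r3)) (sigma3 : 'rV[R]_r3)
    (C : tensor R r1 r2 r3) : Prop :=
  [/\ leading_left_singular (unfold1 X) U1 sigma1,
      leading_left_singular (unfold2 X) U2 sigma2,
      leading_left_singular (unfold3 X) U3 sigma3 &
      C = ttm U1^T U2^T U3^T X].

(* Y, W and Z below are the principal components of X = (D1^-1, D2^-1, D3^-1) F,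
   those of F for the inner product induced by D1^-1, D2^-1, D3^-1, and the
   scaled ones of F, respectively. *)
Definition principal_components n r (U : 'M[R]_(n, r)) (sigma : 'rV[R]_r) :
    'M[R]_(n, r) :=
  U *m diag_mx sigma.

Definition metric_principal_components n r (D : 'M[R]_n)
    (U : 'M[R]_(n, r)) (sigma : 'rV[R]_r) : 'M[R]_(n, r) :=
  D *m principal_components U sigma.

Definition scaled_principal_components n r (D : 'M[R]_n)
    (U : 'M[R]_(n, r)) (sigma : 'rV[R]_r) : 'M[R]_(n, r) :=
  invmx D *m invmx D *m metric_principal_components D U sigma.

End Tensors.

(* Main.v *)
Require Import Defs.
From mathcomp Require Import ring.

(** By symmetry of the three modes consider the first. Since [r_mu] is the rank
    of the mode-[mu] matricization of [X], all retained singular values are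
    nonzero and the columns of [U_mu] span the whole column space, so that
    [U_mu U_mu^T] fixes [X] in mode [mu] ([leading_full_rank]). The truncation
    of [X] is therefore exact: expanding the core back in modes 2 and 3 only,
<<
      (1, U_2, U_3) C = (U_1^T, U_2 U_2^T, U_3 U_3^T) X = (U_1^T, 1, 1) X.
>>
    The factor [Sigma_1] in [B_1] cancels the inverse of [Sigma_1] in [B], and
    the inverses of [Sigma_2], [Sigma_3] cancel the factors [Sigma_2],
    [Sigma_3] of [Z_2 = D_2^-1 U_2 Sigma_2] and [Z_3 = D_3^-1 U_3 Sigma_3].
    Hence [(1, Z_2, Z_3) B_1 = (U_1^T, D_2^-1, D_3^-1) X]. Contracting modes 2
    and 3 with [F = (D_1, D_2, D_3) X], the weights [D_2] and [D_3] cancel as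
    well, and there remains
<<
      D_1 X^(1) (X^(1))^T U_1 = D_1 U_1 Sigma_1^2 = D_1^2 Z_1 Sigma_1,
>>
    because the columns of [U_1] are eigenvectors of the Gram matrix of
    [X^(1)] ([transition_matrix]). As [D_1^2] is the diagonal matrix of the
    marginal, this is the announced formula, entry by entry
    ([transition_formula]).

    Modes 2 and 3 follow by applying the mode-1 formula to tensors with
    permuted indices. The permutations are those for which the matricizations
    in modes 2 and 3 become literally the one in mode 1. *)

Import Order.TTheory GRing.Theory Num.Theory.
Local Open Scope ring_scope.

Set Implicit Arguments.
Unset Strict Implicit.
Unset Printing Implicit Defensive.

(** * Matricization of tensor-times-matrix products *)

(** The Kronecker product of [M3^T] and [M2^T], given as the matrix of
    [S |-> M3 S M2^T] on row-major vectorized matrices: composition and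
    identity laws then come for free. The transposition fits its action from
    the right on the rows of a mode-1 matricization. *)
Definition kron (R : realType) m2 m3 n2 n3
    (M2 : 'M[R]_(m2, n2)) (M3 : 'M[R]_(m3, n3)) : 'M[R]_(n3 * n2, m3 * m2) :=
  lin_mx (mulmxr M2^T \o mulmx M3).

Lemma kronE (R : realType) m2 m3 n2 n3
    (M2 : 'M[R]_(m2, n2)) (M3 : 'M[R]_(m3, n3)) k j k' j' :
  kron M2 M3 (mxvec_index k j) (mxvec_index k' j') = M3 k' k * M2 j' j.
Proof.
rewrite mxE /= vec_mx_delta mxvecE -(mul_delta_mx (0 : 'I_1)) mulmxA.
by rewrite -colE -mulmxA -rowE mxE big_ord1 !mxE.
Qed.

Lemma trmx_kron (R : realType) m2 m3 n2 n3
    (M2 : 'M[R]_(m2, n2)) (M3 : 'M[R]_(m3, n3)) :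
  (kron M2 M3)^T = kron M2^T M3^T.
Proof.
apply/matrixP => x y.
case/mxvec_indexP: x => k j; case/mxvec_indexP: y => k' j'.
by rewrite mxE !kronE !mxE.
Qed.

Lemma mul_kron (R : realType) l2 l3 m2 m3 n2 n3
    (L2 : 'M[R]_(l2, m2)) (L3 : 'M[R]_(l3, m3))
    (M2 : 'M[R]_(m2, n2)) (M3 : 'M[R]_(m3, n3)) :
  kron M2 M3 *m kron L2 L3 = kron (L2 *m M2) (L3 *m M3).
Proof.
apply/row_matrixP => c; rewrite !rowE mulmxA.
by rewrite -[delta_mx _ _]vec_mxK !mul_vec_lin /= trmx_mul !mulmxA.
Qed.

Lemma kron1 (R : realType) n2 n3 : @kron R n2 n3 n2 n3 1%:M 1%:M = 1%:M.
Proof.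
apply/row_matrixP => c; rewrite !rowE mulmx1.
by rewrite -[delta_mx _ _]vec_mxK mul_vec_lin /= trmx1 mulmx1 mul1mx.
Qed.

Lemma unfold1E (R : realType) n1 n2 n3 (A : tensor R n1 n2 n3) i j k :
  unfold1 A i (mxvec_index k j) = A (i, j, k).
Proof. by rewrite mxE mxvecE mxE. Qed.

Lemma unfold1_inj (R : realType) n1 n2 n3 : injective (@unfold1 R n1 n2 n3).
Proof.
move=> A A' eqAA'; apply/ffunP => -[[i j] k].
by rewrite -!unfold1E eqAA'.
Qed.

Lemma unfold1_ttm (R : realType) m1 m2 m3 n1 n2 n3
    (M1 : 'M[R]_(m1, n1)) (M2 : 'M[R]_(m2, n2)) (M3 : 'M[R]_(m3, n3))
    (A : tensor R n1 n2 n3) :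
  unfold1 (ttm M1 M2 M3 A) = M1 *m unfold1 A *m kron M2 M3.
Proof.
apply/matrixP => i c; case/mxvec_indexP: c => k j.
rewrite unfold1E ffunE /= -mulmxA mxE; apply: eq_bigr => a _.
rewrite mxE (reindex _ (curry_mxvec_bij _ _)) /= mulr_sumr.
rewrite exchange_big pair_big /=; apply: eq_bigr => -[c b] _ /=.
by rewrite kronE unfold1E; ring.
Qed.

(** Seen through the injective matricization, this is associativity of the
    matrix product together with multiplicativity of [kron]. *)
Lemma ttm_comp (R : realType) l1 l2 l3 m1 m2 m3 n1 n2 n3
    (L1 : 'M[R]_(l1, m1)) (L2 : 'M[R]_(l2, m2)) (L3 : 'M[R]_(l3, m3))
    (M1 : 'M[R]_(m1, n1)) (M2 : 'M[R]_(m2, n2)) (M3 : 'M[R]_(m3, n3))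
    (A : tensor R n1 n2 n3) :
  ttm L1 L2 L3 (ttm M1 M2 M3 A) = ttm (L1 *m M1) (L2 *m M2) (L3 *m M3) A.
Proof.
by apply: unfold1_inj; rewrite !unfold1_ttm -mul_kron !mulmxA.
Qed.

Lemma ttm1 (R : realType) n1 n2 n3 (A : tensor R n1 n2 n3) :
  ttm 1%:M 1%:M 1%:M A = A.
Proof. by apply: unfold1_inj; rewrite unfold1_ttm kron1 mul1mx mulmx1. Qed.

Lemma ttm1lE (R : realType) m2 m3 n1 n2 n3
    (M2 : 'M[R]_(m2, n2)) (M3 : 'M[R]_(m3, n3)) (A : tensor R n1 n2 n3) i j k :
  ttm 1%:M M2 M3 A (i, j, k) = \sum_b \sum_c M2 j b * M3 k c * A (i, b, c).
Proof.
rewrite ffunE /= (bigD1 i) //= [X in _ + X]big1 ?addr0; last first.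
  move=> a ne_ai; rewrite big1 // => b _; rewrite big1 // => c _.
  by rewrite mxE eq_sym (negPf ne_ai) !mul0r.
by apply: eq_bigr => b _; apply: eq_bigr => c _; rewrite mxE eqxx mul1r.
Qed.

Lemma ttm_fix1 (R : realType) n1 n2 n3 (P : 'M[R]_n1) (A : tensor R n1 n2 n3) :
  P *m unfold1 A = unfold1 A -> ttm P 1%:M 1%:M A = A.
Proof. by move=> PA; apply: unfold1_inj; rewrite unfold1_ttm kron1 mulmx1. Qed.

Lemma rank_unfold1_ttm (R : realType) n1 n2 n3
    (M1 : 'M[R]_n1) (M2 : 'M[R]_n2) (M3 : 'M[R]_n3) (A : tensor R n1 n2 n3) :
    M1 \in unitmx -> M2 \in unitmx -> M3 \in unitmx ->
  \rank (unfold1 (ttm M1 M2 M3 A)) = \rank (unfold1 A).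
Proof.
move=> uM1 uM2 uM3.
rewrite unfold1_ttm mxrankMfree; last first.
  apply/row_freeP; exists (kron (invmx M2) (invmx M3)).
  by rewrite mul_kron !mulVmx // kron1.
by rewrite eqmxMfull // row_full_unit.
Qed.

(** Contracting modes 2 and 3 of two tensors is a matrix product of their
    mode-1 matricizations. *)
Lemma mul_unfold1_tr (R : realType) n1 n2 n3 m1 (A : tensor R n1 n2 n3)
    (G : tensor R m1 n2 n3) i l :
  (unfold1 A *m (unfold1 G)^T) i l =
    \sum_(j < n2) \sum_(k < n3) A (i, j, k) * G (l, j, k).
Proof.
rewrite mxE (reindex _ (curry_mxvec_bij _ _)) /= exchange_big pair_big /=.
by apply: eq_bigr => -[k j] _; rewrite [X in _ * X]mxE !unfold1E.
Qed.

(** * Exchanging the modes *)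

Definition swap12 (R : realType) n1 n2 n3 (A : tensor R n1 n2 n3) :
    tensor R n2 n1 n3 :=
  [ffun t => A (t.1.2, t.1.1, t.2)].

(** Mode 3 is brought to the front by a rotation and not by a transposition,
    as [unfold3] orders its columns by mode 2, then mode 1. *)
Definition rotate (R : realType) n1 n2 n3 (A : tensor R n1 n2 n3) :
    tensor R n3 n1 n2 :=
  [ffun t => A (t.1.2, t.2, t.1.1)].

Lemma unfold2_swap12 (R : realType) n1 n2 n3 (A : tensor R n1 n2 n3) :
  unfold2 A = unfold1 (swap12 A).
Proof.
apply/matrixP => j c; case/mxvec_indexP: c => k i.
by rewrite unfold1E mxE mxvecE mxE ffunE.
Qed.

Lemma unfold3_rotate (R : realType) n1 n2 n3 (A : tensor R n1 n2 n3) :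
  unfold3 A = unfold1 (rotate A).
Proof.
apply/matrixP => k c; case/mxvec_indexP: c => j i.
by rewrite unfold1E mxE mxvecE mxE ffunE.
Qed.

Lemma swap12_ttm (R : realType) m1 m2 m3 n1 n2 n3
    (M1 : 'M[R]_(m1, n1)) (M2 : 'M[R]_(m2, n2)) (M3 : 'M[R]_(m3, n3))
    (A : tensor R n1 n2 n3) :
  swap12 (ttm M1 M2 M3 A) = ttm M2 M1 M3 (swap12 A).
Proof.
apply/ffunP => -[[j i] k]; rewrite !ffunE /= exchange_big.
apply: eq_bigr => b _; apply: eq_bigr => a _; apply: eq_bigr => c _.
by rewrite ffunE /=; ring.
Qed.

Lemma rotate_ttm (R : realType) m1 m2 m3 n1 n2 n3
    (M1 : 'M[R]_(m1, n1)) (M2 : 'M[R]_(m2, n2)) (M3 : 'M[R]_(m3, n3))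
    (A : tensor R n1 n2 n3) :
  rotate (ttm M1 M2 M3 A) = ttm M3 M1 M2 (rotate A).
Proof.
apply/ffunP => -[[k i] j]; rewrite !ffunE /= [RHS]exchange_big.
apply: eq_bigr => a _; rewrite [RHS]exchange_big.
apply: eq_bigr => b _; apply: eq_bigr => c _.
by rewrite ffunE /=; ring.
Qed.

Lemma swap12_inj (R : realType) n1 n2 n3 : injective (@swap12 R n1 n2 n3).
Proof.
move=> A A' eqA; apply/ffunP => -[[i j] k].
by move/ffunP/(_ (j, i, k)): eqA; rewrite !ffunE.
Qed.

Lemma rotate_inj (R : realType) n1 n2 n3 : injective (@rotate R n1 n2 n3).
Proof.
move=> A A' eqA; apply/ffunP => -[[i j] k].
by move/ffunP/(_ (k, i, j)): eqA; rewrite !ffunE.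
Qed.

(** * Truncated singular value decompositions of full rank *)

(** In a nonincreasing list of nonnegative numbers all entries from the first
    zero on vanish, so that only the first [l] rows can be nonzero. *)
Lemma rank_pseudo_diag_le (R : realType) m n (s : seq R) l :
    sorted >=%R s -> {in s, forall x, 0 <= x} -> s`_l = 0 ->
  (\rank (\matrix_(i < m, j < n) (s`_i *+ (i == j :> nat)) : 'M[R]_(m, n))
     <= l)%N.
Proof.
move=> s_dec s_ge0 sl0.
have s0 i : (l <= i)%N -> s`_i = 0.
  move=> le_li.
  have [lt_is | le_si] := ltnP i (size s); last by rewrite nth_default.
  apply/eqP; rewrite eq_le s_ge0 ?mem_nth // andbT -[leRHS]sl0.
  have s_homo := sorted_leq_nth (rev_trans le_trans) (@lexx _ _) 0 s_dec.
  by apply: (s_homo l i) => //; rewrite inE (leq_ltn_trans le_li).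
set S := (\matrix_(i, j) _).
suff -> : S = (pid_mx l : 'M_m) *m S.
  apply: leq_trans (mxrankM_maxl _ _) _.
  have [le_lm | lt_ml] := leqP l m; first by rewrite rank_pid_mx.
  exact: leq_trans (rank_leq_row _) (ltnW lt_ml).
apply/matrixP => i j; rewrite [RHS]mxE (bigD1 i) //= big1 ?addr0; last first.
  move=> i' ne_i'i; rewrite !mxE -val_eqE /= in ne_i'i *.
  by rewrite eq_sym (negPf ne_i'i) mul0r.
rewrite !mxE eqxx /=; case: ltnP => [_ | /s0 ->]; first by rewrite mul1r.
by rewrite mul0rn mulr0.
Qed.

(** A zero among the first [r] singular values would force the rank below [r].
    Each [u_l] is then [sigma_l^-1 A v_l], in the column space of [A], whose
    dimension is also [r]: the columns of [U] form an orthonormal basis of it,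
    and [U U^T] is the orthogonal projection onto it. *)
Lemma leading_full_rank (R : realType) m n r (A : 'M[R]_(m, n))
    (U : 'M[R]_(m, r)) (sigma : 'rV[R]_r) :
    leading_left_singular A U sigma -> \rank A = r ->
  [/\ diag_mx sigma \in unitmx, U *m U^T *m A = A &
      A *m A^T *m U = U *m diag_mx sigma *m diag_mx sigma].
Proof.
case=> -[s [[_ s_dec s_ge0 [P [Q [PK QK defA]]]] _ sigmaE]] UK sing rA.
have sigma_neq0 l : sigma 0 l != 0.
  apply: contraTneq (ltn_ord l) => sl0.
  rewrite -leqNgt -[X in (X <= _)%N]rA defA.
  apply: leq_trans (mxrankM_maxl _ _) _; apply: leq_trans (mxrankM_maxr _ _) _.
  by apply: rank_pseudo_diag_le; rewrite // -sigmaE.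
have uS : diag_mx sigma \in unitmx.
  rewrite unitmxE det_diag unitfE; apply/prodf_neq0 => l _.
  exact: sigma_neq0.
split=> //.
  have sUA : (U^T <= A^T)%MS.
    apply/row_subP => l; have [_ [v [_ Av _]]] := sing l.
    rewrite -tr_col; apply/submxP; exists ((sigma 0 l)^-1 *: v^T).
    by rewrite -scalemxAl -trmx_mul Av linearZ scalerA mulVf ?scale1r.
  have rU : \rank U^T = r.
    by apply/eqP/row_freeP; exists U.
  have /andP[_ /submxP[M defM]] : (U^T == A^T)%MS.
    by rewrite -(mxrank_leqif_eq sUA) rU mxrank_tr rA.
  by rewrite -[A]trmxK defM trmx_mul trmxK -mulmxA (mulmxA U^T) UK mul1mx.
apply/matrixP => i l.
have [_ [v [_ Av ATu]]] := sing l.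
have -> : (A *m A^T *m U) i l = (A *m (A^T *m col l U)) i 0.
  by rewrite colE !mulmxA -colE [RHS]mxE.
by rewrite ATu -scalemxAr Av !mul_mx_diag !mxE; ring.
Qed.

(** * Transition formulas *)

(** The mode-1 formula before division by the marginal and by the singular
    value. *)
Lemma transition_matrix (R : realType) n1 n2 n3 r1 r2 r3
    (A : tensor R n1 n2 n3)
    (D1 : 'M[R]_n1) (D2 : 'M[R]_n2) (D3 : 'M[R]_n3)
    (U1 : 'M[R]_(n1, r1)) (U2 : 'M[R]_(n2, r2)) (U3 : 'M[R]_(n3, r3))
    (S1 : 'M[R]_r1) (S2 : 'M[R]_r2) (S3 : 'M[R]_r3)
    (B1 : tensor R r1 r2 r3) :
  let X := ttm (invmx D1) (invmx D2) (invmx D3) A in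
  let C := ttm U1^T U2^T U3^T X in
    D1 \in unitmx -> D2 \in unitmx -> D3 \in unitmx ->
    D2^T = D2 -> D3^T = D3 ->
    S1 \in unitmx -> S2 \in unitmx -> S3 \in unitmx ->
    unfold1 X *m (unfold1 X)^T *m U1 = U1 *m S1 *m S1 ->
    ttm 1%:M (U2 *m U2^T) 1%:M X = X ->
    ttm 1%:M 1%:M (U3 *m U3^T) X = X ->
    unfold1 B1 = S1 *m unfold1 (ttm (invmx S1) (invmx S2) (invmx S3) C) ->
  unfold1 A *m (unfold1 (ttm 1%:M (invmx D2 *m U2 *m S2)
                                  (invmx D3 *m U3 *m S3) B1))^T =
    D1 *m U1 *m S1 *m S1.
Proof.
move=> X C uD1 uD2 uD3 tD2 tD3 uS1 uS2 uS3 gramX fix2 fix3 defB1.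
have defA : A = ttm D1 D2 D3 X by rewrite ttm_comp !mulmxV // ttm1.
clearbody X; have {}defB1 : B1 = ttm 1%:M (invmx S2) (invmx S3) C.
  by apply: unfold1_inj; rewrite defB1 !unfold1_ttm !mulmxA mulmxV.
have -> : ttm 1%:M (invmx D2 *m U2 *m S2) (invmx D3 *m U3 *m S3) B1 =
          ttm U1^T (invmx D2) (invmx D3) X.
  rewrite defB1 /C !ttm_comp !mul1mx -!(mulmxA _ S2) -!(mulmxA _ S3) !mulmxV //.
  rewrite !mulmx1.
  (* The truncation in modes 2 and 3 loses nothing. *)
  by rewrite -[in RHS]fix3 -[in RHS]fix2 !ttm_comp !mulmx1 !mulmxA.
(* The weights of modes 2 and 3 cancel, leaving the Gram matrix. *)
rewrite defA !unfold1_ttm !trmx_mul trmxK trmx_kron !trmx_inv tD2 tD3.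
rewrite !mulmxA -(mulmxA _ (kron D2 D3)) mul_kron !mulVmx // kron1 mulmx1.
by rewrite -(mulmxA D1) -mulmxA -(mulmxA D1) gramX !mulmxA.
Qed.

Lemma diag_sqrt_unit (R : realType) n (f : 'rV[R]_n) :
  (forall i, 0 < f 0 i) -> diag_sqrt f \in unitmx.
Proof.
move=> f_gt0; rewrite unitmxE det_diag unitfE; apply/prodf_neq0 => i _.
by rewrite mxE sqrtr_eq0 -ltNge.
Qed.

Lemma scaled_principal_componentsE (R : realType) n r (D : 'M[R]_n)
    (U : 'M[R]_(n, r)) (sigma : 'rV[R]_r) :
    D \in unitmx ->
  scaled_principal_components D U sigma = invmx D *m U *m diag_mx sigma.
Proof.
by move=> uD; rewrite /scaled_principal_components -mulmxA mulKmx // mulmxA.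
Qed.

(** Arbitrary positive weights, in place of the marginals of [A], keep the
    statement stable under permutations of the modes: no marginal of a permuted
    tensor has to be computed. *)
Lemma transition_formula (R : realType) n1 n2 n3 r1 r2 r3
    (A : tensor R n1 n2 n3) (f1 : 'rV[R]_n1) (f2 : 'rV[R]_n2) (f3 : 'rV[R]_n3)
    (U1 : 'M[R]_(n1, r1)) (U2 : 'M[R]_(n2, r2)) (U3 : 'M[R]_(n3, r3))
    (sigma1 : 'rV[R]_r1) (sigma2 : 'rV[R]_r2) (sigma3 : 'rV[R]_r3)
    (B1 : tensor R r1 r2 r3) :
  let D1 := diag_sqrt f1 in
  let D2 := diag_sqrt f2 in
  let D3 := diag_sqrt f3 in
  let S1 := diag_mx sigma1 in
  let S2 := diag_mx sigma2 in
  let S3 := diag_mx sigma3 in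
  let Z1 := scaled_principal_components D1 U1 sigma1 in
  let Z2 := scaled_principal_components D2 U2 sigma2 in
  let Z3 := scaled_principal_components D3 U3 sigma3 in
  let X := ttm (invmx D1) (invmx D2) (invmx D3) A in
  let C := ttm U1^T U2^T U3^T X in
    (forall i, 0 < f1 0 i) -> (forall j, 0 < f2 0 j) ->
    (forall k, 0 < f3 0 k) ->
    S1 \in unitmx -> S2 \in unitmx -> S3 \in unitmx ->
    unfold1 X *m (unfold1 X)^T *m U1 = U1 *m S1 *m S1 ->
    ttm 1%:M (U2 *m U2^T) 1%:M X = X ->
    ttm 1%:M 1%:M (U3 *m U3^T) X = X ->
    unfold1 B1 = S1 *m unfold1 (ttm (invmx S1) (invmx S2) (invmx S3) C) ->
  forall i l, Z1 i l = (sigma1 0 l)^-1 *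
    \sum_(j < n2) \sum_(k < n3) \sum_(m < r2) \sum_(p < r3)
      A (i, j, k) / f1 0 i * Z3 k p * Z2 j m * B1 (l, m, p).
Proof.
move=> D1 D2 D3 S1 S2 S3 Z1 Z2 Z3 X C f1_gt0 f2_gt0 f3_gt0 uS1 uS2 uS3.
move=> gramX fix2 fix3 defB1 i l.
have uD1 : D1 \in unitmx by apply: diag_sqrt_unit.
have uD2 : D2 \in unitmx by apply: diag_sqrt_unit.
have uD3 : D3 \in unitmx by apply: diag_sqrt_unit.
have sigma_neq0 : sigma1 0 l != 0.
  by move: uS1; rewrite unitmxE det_diag unitfE => /prodf_neq0; apply.
have f1_neq0 : f1 0 i != 0 by rewrite gt_eqF.
have := transition_matrix uD1 uD2 uD3 (tr_diag_mx _) (tr_diag_mx _)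
  uS1 uS2 uS3 gramX fix2 fix3 defB1.
rewrite -!scaled_principal_componentsE // -/Z2 -/Z3.
have -> : D1 *m U1 *m S1 *m S1 = D1 *m (D1 *m Z1) *m S1.
  by rewrite /Z1 scaled_principal_componentsE // !mulmxA mulmxK.
clearbody Z1; move/matrixP/(_ i l).
rewrite mul_unfold1_tr mul_mx_diag mxE !mul_diag_mx.
rewrite !mxE mulrA -expr2 sqr_sqrtr ?ltW // => sumE.
transitivity ((sigma1 0 l)^-1 * ((f1 0 i)^-1 * (f1 0 i * Z1 i l * sigma1 0 l))).
  by field; rewrite f1_neq0.
congr (_ * _); rewrite -sumE mulr_sumr; apply: eq_bigr => j _.
rewrite mulr_sumr; apply: eq_bigr => k _.
rewrite ttm1lE !mulr_sumr; apply: eq_bigr => m _.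
by rewrite !mulr_sumr; apply: eq_bigr => p _; ring.
Qed.

Lemma sumr2_gt0 (R : realType) m n (G : 'I_m -> 'I_n -> R) :
    (forall a b, 0 <= G a b) -> \sum_a \sum_b G a b <> 0 ->
  0 < \sum_a \sum_b G a b.
Proof.
move=> G_ge0 /eqP G_neq0; rewrite lt0r G_neq0 sumr_ge0 // => a _.
exact: sumr_ge0.
Qed.

Lemma frequency_ge0 (R : realType) n1 n2 n3 (T : tensor nat n1 n2 n3) t :
  0 <= frequency R T t.
Proof. by rewrite ffunE divr_ge0 ?ler0n. Qed.

Theorem proposition5 (R : realType) (n1 n2 n3 r1 r2 r3 : nat)
    (T : tensor nat n1 n2 n3)
    (U1 : 'M[R]_(n1, r1)) (sigma1 : 'rV[R]_r1)
    (U2 : 'M[R]_(n2, r2)) (sigma2 : 'rV[R]_r2)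
    (U3 : 'M[R]_(n3, r3)) (sigma3 : 'rV[R]_r3)
    (C B1 B2 B3 : tensor R r1 r2 r3) :
  let F := frequency R T in
  let f1 := marginal1 F in
  let f2 := marginal2 F in
  let f3 := marginal3 F in
  let D1 := diag_sqrt f1 in
  let D2 := diag_sqrt f2 in
  let D3 := diag_sqrt f3 in
  let X := ttm (invmx D1) (invmx D2) (invmx D3) F in
  let Sigma1 := diag_mx sigma1 in
  let Sigma2 := diag_mx sigma2 in
  let Sigma3 := diag_mx sigma3 in
  let Z1 := scaled_principal_components D1 U1 sigma1 in
  let Z2 := scaled_principal_components D2 U2 sigma2 in
  let Z3 := scaled_principal_components D3 U3 sigma3 in
  let B := ttm (invmx Sigma1) (invmx Sigma2) (invmx Sigma3) C in
  (exists i j k, T (i, j, k) <> 0%N) ->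
  (forall i, f1 0 i <> 0) ->
  (forall j, f2 0 j <> 0) ->
  (forall k, f3 0 k <> 0) ->
  is_hosvd X U1 sigma1 U2 sigma2 U3 sigma3 C ->
  r1 = \rank (unfold1 F) ->
  r2 = \rank (unfold2 F) ->
  r3 = \rank (unfold3 F) ->
  unfold1 B1 = Sigma1 *m unfold1 B ->
  unfold2 B2 = Sigma2 *m unfold2 B ->
  unfold3 B3 = Sigma3 *m unfold3 B ->
  forall (i : 'I_n1) (j : 'I_n2) (k : 'I_n3)
         (l : 'I_r1) (m : 'I_r2) (p : 'I_r3),
  [/\ Z1 i l = (sigma1 0 l)^-1 *
        \sum_(j' < n2) \sum_(k' < n3) \sum_(m' < r2) \sum_(p' < r3)
          F (i, j', k') / f1 0 i * Z3 k' p' * Z2 j' m' * B1 (l, m', p'),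
      Z2 j m = (sigma2 0 m)^-1 *
        \sum_(i' < n1) \sum_(k' < n3) \sum_(l' < r1) \sum_(p' < r3)
          F (i', j, k') / f2 0 j * Z3 k' p' * Z1 i' l' * B2 (l', m, p') &
      Z3 k p = (sigma3 0 p)^-1 *
        \sum_(i' < n1) \sum_(j' < n2) \sum_(l' < r1) \sum_(m' < r2)
          F (i', j', k) / f3 0 k * Z1 i' l' * Z2 j' m' * B3 (l', m', p)].
Proof.
move=> F f1 f2 f3 D1 D2 D3 X Sigma1 Sigma2 Sigma3 Z1 Z2 Z3 B _ f1_neq0 f2_neq0.
move=> f3_neq0 [H1 H2 H3 defC] r1E r2E r3E defB1 defB2 defB3 i j k l m p.
have F_ge0 t : 0 <= F t by apply: frequency_ge0.
have f1_gt0 a : 0 < f1 0 a.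
  by move: (f1_neq0 a); rewrite mxE; apply: sumr2_gt0.
have f2_gt0 a : 0 < f2 0 a.
  by move: (f2_neq0 a); rewrite mxE; apply: sumr2_gt0.
have f3_gt0 a : 0 < f3 0 a.
  by move: (f3_neq0 a); rewrite mxE; apply: sumr2_gt0.
have uD1 : invmx D1 \in unitmx by rewrite unitmx_inv diag_sqrt_unit.
have uD2 : invmx D2 \in unitmx by rewrite unitmx_inv diag_sqrt_unit.
have uD3 : invmx D3 \in unitmx by rewrite unitmx_inv diag_sqrt_unit.
have X2E : swap12 X = ttm (invmx D2) (invmx D1) (invmx D3) (swap12 F).
  exact: swap12_ttm.
have X3E : rotate X = ttm (invmx D3) (invmx D1) (invmx D2) (rotate F).
  exact: rotate_ttm.
have rX1 : \rank (unfold1 X) = r1 by rewrite r1E rank_unfold1_ttm.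
have rX2 : \rank (unfold2 X) = r2.
  by rewrite r2E !unfold2_swap12 X2E rank_unfold1_ttm.
have rX3 : \rank (unfold3 X) = r3.
  by rewrite r3E !unfold3_rotate X3E rank_unfold1_ttm.
have [uS1 fixU1 gram1] := leading_full_rank H1 rX1.
have [uS2 fixU2 gram2] := leading_full_rank H2 rX2.
have [uS3 fixU3 gram3] := leading_full_rank H3 rX3.
have fix1 : ttm (U1 *m U1^T) 1%:M 1%:M X = X by apply: ttm_fix1.
have fix2 : ttm 1%:M (U2 *m U2^T) 1%:M X = X.
  by apply: swap12_inj; rewrite swap12_ttm ttm_fix1 // -unfold2_swap12.
have fix3 : ttm 1%:M 1%:M (U3 *m U3^T) X = X.
  by apply: rotate_inj; rewrite rotate_ttm ttm_fix1 // -unfold3_rotate.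
split.
- by apply: transition_formula; rewrite // -defC.
- have -> := @transition_formula R n2 n1 n3 r2 r1 r3 (swap12 F) f2 f1 f3
    U2 U1 U3 sigma2 sigma1 sigma3 (swap12 B2) f2_gt0 f1_gt0 f3_gt0 uS2 uS1 uS3
    _ _ _ _ j m.
  + congr (_ * _); do 4![apply: eq_bigr => ? _]; by rewrite !ffunE.
  + by rewrite -X2E -unfold2_swap12.
  + by rewrite -X2E -swap12_ttm fix1.
  + by rewrite -X2E -swap12_ttm fix3.
  + by rewrite -X2E -!swap12_ttm -!unfold2_swap12 -defC.
- have -> := @transition_formula R n3 n1 n2 r3 r1 r2 (rotate F) f3 f1 f2
    U3 U1 U2 sigma3 sigma1 sigma2 (rotate B3) f3_gt0 f1_gt0 f2_gt0 uS3 uS1 uS2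
    _ _ _ _ k p.
  + congr (_ * _); do 4![apply: eq_bigr => ? _]; by rewrite !ffunE /=; ring.
  + by rewrite -X3E -unfold3_rotate.
  + by rewrite -X3E -rotate_ttm fix1.
  + by rewrite -X3E -rotate_ttm fix2.
  + by rewrite -X3E -!rotate_ttm -!unfold3_rotate -defC.
Qed.
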